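(* The longest-edge altitude bisection dynamics collapses the whole shape space $\Sigma$ onto the curve $\Gamma$ of right triangles in a single refinement step, and every point of $\Gamma$ is fixed. That is, $W_L(\Sigma)=W_R(\Sigma)=\Gamma$, and $W_L(z)=W_R(z)=z$ for every $z\in\Gamma$.
   Context: Shape space: $\Sigma=\{z\in\mathbb C: 0<\Re(z)\le\tfrac12,\ \Im(z)>0,\ |z-1|\le1\}$. Every nondegenerate triangle in the plane is similar (reflections allowed) to a triangle with vertices $0,1,z$ for a unique $z\in\Sigma$, called its normalization: the longest edge is placed on $[0,1]$, the third vertex lies in the upper half-plane, and the shortest edge is attached to $0$. Right triangles correspond to $\Gamma=\{z\in\Sigma: |z-\tfrac12|=\tfrac12\}$. Longest-edge altitude bisection (LEAB): a triangle is subdivided into two triangles by the altitude dropped from the vertex opposite its longest edge. For the triangle with vertices $0,1,z$, $z\in\Sigma$ (longest edge $[0,1]$), the left child is the triangle with vertices $0,\Re(z),z$ and the right child is the triangle with vertices $\Re(z),1,z$. The maps $W_L,W_R:\Sigma\to\Sigma$ send $z$ to the normalization of the left and right child, respectively. *)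

(* Defs.v *)
From mathcomp Require Import all_boot all_order all_algebra.
From mathcomp Require Import complex ring lra.
From mathcomp Require Import boolp classical_sets reals.

Set Implicit Arguments.
Unset Strict Implicit.
Unset Printing Implicit Defensive.

Import Order.TTheory GRing.Theory Num.Theory.

Local Open Scope classical_set_scope.
Local Open Scope ring_scope.
Local Open Scope complex_scope.

(* The order and the norm on [R[i]] are complex-valued: [u <= v] means that
   [v - u] is a nonnegative real, and [`|z|] is the modulus seen in [R[i]],
   whereas [complex.Re z] and [complex.Im z] are elements of [R]. *)

Definition Sigma (R : realType) : set R[i] :=
  [set z | [/\ 0 < complex.Re z, complex.Re z <= 2^-1,
              0 < complex.Im z & `|z - 1| <= 1]].

Definition Gamma (R : realType) : set R[i] :=
  [set z | Sigma z /\ `|z - 2^-1| = 2^-1].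

(* Orientation-reversing maps are allowed. *)
Definition similarity (R : realType) (f : R[i] -> R[i]) : Prop :=
  exists2 k : R, 0 < k & forall u v, `|f u - f v| = k%:C * `|u - v|.

(* A triangle is represented by its unordered set of vertices. *)
Definition triangle (R : realType) (a b c : R[i]) : set R[i] := [set a; b; c].

Definition nondegenerate (R : realType) (a b c : R[i]) : Prop :=
  complex.Im ((b - a)^* * (c - a)) != 0.

Definition similar (R : realType) (S T : set R[i]) : Prop :=
  exists2 f, similarity f & f @` S = T.

(* The default value 0 is never returned on a nondegenerate triangle:
   see [normalization_exists] and [normalization_unique]. *)
Definition normalization (R : realType) (T : set R[i]) : R[i] :=
  xget 0 [set w | Sigma w /\ similar T (triangle 0 1 w)].

(* The foot of the altitude from [z] to the edge [0, 1] is [complex.Re z]. *)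
Definition left_child (R : realType) (z : R[i]) : set R[i] :=
  triangle 0 (complex.Re z)%:C z.

Definition right_child (R : realType) (z : R[i]) : set R[i] :=
  triangle (complex.Re z)%:C 1 z.

Definition W_L (R : realType) (z : R[i]) : R[i] := normalization (left_child z).

Definition W_R (R : realType) (z : R[i]) : R[i] := normalization (right_child z).

Section Normalization.
Variable R : realType.
Implicit Types (a b c u v w z : R[i]) (f : R[i] -> R[i]).

Let d2 u v : R := (complex.Re u - complex.Re v) ^+ 2 + (complex.Im u - complex.Im v) ^+ 2.

Let norm_d2 u v : `|u - v| ^+ 2 = (d2 u v)%:C.
Proof. case: u v => [x y] [s t]; rewrite sqr_normc /d2; simpc.
by congr (_ +i* _); ring. Qed.

Let d2C u v : d2 u v = d2 v u.
Proof. by rewrite /d2; ring. Qed.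

Let d2_gt0 u v : u != v -> 0 < d2 u v.
Proof.
move=> uv; have : 0 < `|u - v| ^+ 2 by rewrite exprn_gt0// normr_gt0 subr_eq0.
by rewrite norm_d2 ltcR.
Qed.

Let Sigma_d2 w : Sigma w <->
  [/\ d2 0 w <= d2 1 w, d2 1 w <= 1 & 0 < complex.Im w].
Proof.
have -> : Sigma w <-> [/\ 0 < complex.Re w, complex.Re w <= 2^-1, 0 < complex.Im w & d2 1 w <= 1].
  rewrite /Sigma /= d2C.
  have -> : (`|w - 1| <= 1) = (d2 w 1 <= 1).
    by rewrite -(@expr_le1 _ 2)// norm_d2 lecR.
  by [].
case: w => x y; rewrite /d2 /=; split.
  by move=> [? ? ? ?]; split; nra.
by move=> [? ? ?]; split; nra.
Qed.

Let sim_d2 f : similarity f ->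
  exists2 k : R, 0 < k & forall u v, d2 (f u) (f v) = k * d2 u v.
Proof.
move=> [k k0 fk]; exists (k ^+ 2); first by rewrite exprn_gt0.
move=> u v; apply: (@complexI R).
by rewrite -norm_d2 fk exprMn norm_d2 !rmorphM.
Qed.


Let d2_inj w w' : 0 < complex.Im w -> 0 < complex.Im w' ->
  d2 0 w = d2 0 w' -> d2 1 w = d2 1 w' -> w = w'.
Proof.
case: w w' => [x y] [s t]; rewrite /d2 /= => y0 t0 e0 e1.
have xs : x = s by lra.
suff -> : y = t by rewrite xs.
have : (y - t) * (y + t) = 0 by move: e0; rewrite xs => e0; lra.
move=> /eqP; rewrite mulf_eq0 => /orP[] /eqP ?; lra.
Qed.

Let rigid w w' u0 u1 u2 (k : R) : 0 < k -> Sigma w -> Sigma w' ->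
  triangle 0 1 w' u0 -> triangle 0 1 w' u1 -> triangle 0 1 w' u2 ->
  d2 u0 u1 = k * d2 0 1 -> d2 u0 u2 = k * d2 0 w -> d2 u1 u2 = k * d2 1 w ->
  w = w'.
Proof.
move=> k0 /Sigma_d2[pq q1 w0] /Sigma_d2[pq' q1' w0'].
have d01 : d2 0 1 = 1 by rewrite /d2 /=; ring.
have duu u : d2 u u = 0 by rewrite /d2; ring.
have gt0 v (x : R) : 0 < complex.Im v -> 0 < d2 x%:C v.
  by case: v => s t /= t0; rewrite /d2 /= sub0r sqrrN ltr_wpDl ?sqr_ge0 ?exprn_gt0.
have p0 := gt0 w 0 w0; have q0 := gt0 w 1 w0.
have p0' := gt0 w' 0 w0'; have q0' := gt0 w' 1 w0'.
rewrite d01 mulr1.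
have kp : 0 < k * d2 0 w by rewrite mulr_gt0.
have kpq : k * d2 0 w <= k * d2 1 w by rewrite ler_pM2l.
have kq1 : k * d2 1 w <= k by rewrite ger_pMr.
move=> t0 t1 t2 e01 e02 e12.
suff [k1 ep eq] : [/\ k = 1, k * d2 0 w = d2 0 w' & k * d2 1 w = d2 1 w'].
  by move: ep eq; rewrite k1 !mul1r; exact: d2_inj.
move: t0 t1 t2 e01 e02 e12.
by move=> [[->|->]|->] [[->|->]|->] [[->|->]|->];
  rewrite ?duu ?(d2C 1 0) ?(d2C w') ?d01 => *; split; lra.
Qed.

Lemma normalization_unique (T : set R[i]) w w' :
  Sigma w -> similar T (triangle 0 1 w) ->
  Sigma w' -> similar T (triangle 0 1 w') -> w = w'.
Proof.
move=> Sw [f /sim_d2[k k0 fk] fT] Sw' [g /sim_d2[l l0 gl] gT].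
have preim u : triangle 0 1 w u -> exists2 x, T x & f x = u by rewrite -fT.
have [x0 T0 f0] := preim 0 (or_introl (or_introl erefl)).
have [x1 T1 f1] := preim 1 (or_introl (or_intror erefl)).
have [x2 T2 f2] := preim w (or_intror erefl).
have gT' x : T x -> triangle 0 1 w' (g x) by rewrite -gT => Tx; exists x.
have dgf x y : d2 (g x) (g y) = l / k * d2 (f x) (f y).
  by rewrite gl fk mulrA divfK// gt_eqF.
apply: (rigid (k := l / k) _ Sw Sw' (gT' _ T0) (gT' _ T1) (gT' _ T2)).
- by rewrite divr_gt0.
- by rewrite dgf f0 f1.
- by rewrite dgf f0 f2.
- by rewrite dgf f1 f2.
Qed.

Let sorted_exists a b c : nondegenerate a b c ->
  d2 a c <= d2 b c -> d2 b c <= d2 a b ->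
  exists2 w, Sigma w & similar (triangle a b c) (triangle 0 1 w).
Proof.
move=> nd ac_bc bc_ab.
have ba : b - a != 0.
  by apply: contraNneq nd => ->; rewrite rmorph0 mul0r.
have ab0 : 0 < d2 a b by apply: d2_gt0; rewrite eq_sym -subr_eq0.
pose f u := (u - a) / (b - a).
have f0 : f a = 0 by rewrite /f subrr mul0r.
have f1 : f b = 1 by rewrite /f divff.
have fsim : similarity f.
  have Re_k : (complex.Re `|b - a|^-1)%:C = `|b - a|^-1.
    by rewrite RRe_real// ger0_real// invr_ge0.
  exists (complex.Re `|b - a|^-1); first by rewrite -ltcR Re_k invr_gt0 normr_gt0.
  move=> u v; rewrite /f -mulrBl opprB addrA subrK normrM normfV mulrC.
  by rewrite Re_k.
have conjsim : similarity (fun u => (f u)^*).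
  have [k k0 fk] := fsim; exists k => // u v.
  by rewrite -rmorphB normcJ.
have im (g : R[i] -> R[i]) : g a = 0 -> g b = 1 -> g @` triangle a b c = triangle 0 1 (g c).
  by move=> ga gb; rewrite /triangle !image_setU !image_set1 ga gb.
have [k k0 fk] := sim_d2 fsim.
have fc_sorted : d2 0 (f c) <= d2 1 (f c) /\ d2 1 (f c) <= 1.
  have <- : d2 0 1 = 1 by rewrite /d2 /=; ring.
  by rewrite -f0 -f1 !fk !ler_pM2l.
have Imf : complex.Im (f c) != 0.
  apply: contraNneq nd => Im0.
  have -> : c - a = (b - a) * f c by rewrite /f mulrCA divff ?mulr1.
  move: Im0; case: (f c) (b - a) => [x y] [s t] /= ->.
  by simpc; apply/eqP => /=; ring.
have [Im0|Im0] := ltP 0 (complex.Im (f c)).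
  exists (f c); first by apply/Sigma_d2; case: fc_sorted.
  by exists f => //; exact: im.
exists (f c)^*.
  apply/Sigma_d2; have {Im0} : complex.Im (f c) < 0 by rewrite lt_neqAle Imf.
  move: fc_sorted; case: (f c) => x y /=; rewrite /d2 /= => -[? ?] ?.
  by split; lra.
exists (fun u => (f u)^*) => //.
by apply: (im (fun u => (f u)^*)); rewrite ?f0 ?f1 ?rmorph0 ?rmorph1.
Qed.

Lemma normalization_exists a b c : nondegenerate a b c ->
  exists2 w, Sigma w & similar (triangle a b c) (triangle 0 1 w).
Proof.
move=> nd.
have swap u v w : triangle u v w = triangle v u w.
  by rewrite /triangle (setUC [set u]).
have rot u v w : triangle u v w = triangle v w u.
  by rewrite /triangle [RHS]setUC setUA.
have nd_swap u v w : nondegenerate u v w -> nondegenerate v u w.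
  case: u v w => [? ?] [? ?] [? ?]; rewrite /nondegenerate; simpc => /= h.
  by apply: contraNneq h => h; apply/eqP; lra.
have nd_rot u v w : nondegenerate u v w -> nondegenerate v w u.
  case: u v w => [? ?] [? ?] [? ?]; rewrite /nondegenerate; simpc => /= h.
  by apply: contraNneq h => h; apply/eqP; lra.
have nd_bca := nd_rot _ _ _ nd; have nd_cab := nd_rot _ _ _ nd_bca.
have dba := d2C b a; have dcb := d2C c b; have dac := d2C a c.
have [ab_bc|/ltW bc_ab] := leP (d2 a b) (d2 b c);
  have [bc_ca|/ltW ca_bc] := leP (d2 b c) (d2 c a);
  have [ca_ab|/ltW ab_ca] := leP (d2 c a) (d2 a b).
all: first
  [ by apply: sorted_exists => //; lra
  | by rewrite rot; apply: sorted_exists => //; lra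
  | by rewrite -rot; apply: sorted_exists => //; lra
  | by rewrite swap; apply: sorted_exists; [exact: nd_swap|lra|lra]
  | by rewrite rot swap; apply: sorted_exists; [exact: nd_swap|lra|lra]
  | by rewrite -rot swap; apply: sorted_exists; [exact: nd_swap|lra|lra] ].
Qed.

End Normalization.

(* Main.v *)
Require Import Defs.
From mathcomp Require Import all_boot all_order all_algebra.
From mathcomp Require Import complex boolp classical_sets reals.
From mathcomp Require Import ring lra.

Import Order.TTheory GRing.Theory Num.Theory.
Local Open Scope classical_set_scope.
Local Open Scope ring_scope.

(** Both children have a right angle at the foot of the altitude, so their
    normalizations lie on [Gamma]. If [z = x + i y] lies on [Gamma], then
    [y ^ 2 = x (1 - x)] and the altitude theorem makes both children similar
    to the triangle itself; hence the points of [Gamma] are fixed, and the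
    images of [Sigma] are all of [Gamma]. *)

Section RightTriangles.
Variable R : realType.
Implicit Types (p q c w z : R[i]) (s t x y : R) (T : set R[i]).
Local Open Scope complex_scope.

(** Since normalizations are unique, exhibiting one similarity onto a triangle with apex in [Sigma]
    determines the value picked by [xget]. *)
Lemma normalizationE T w :
  Sigma w -> Defs.similar T (triangle 0 1 w) -> normalization T = w.
Proof.
move=> Sw simw; rewrite /normalization.
(* The default value is excluded because [w] itself is a candidate. *)
case: xgetP => [v _ [Sv simv]|/(_ w)[]//].
exact: normalization_unique Sv simv Sw simw.
Qed.

Lemma triangle_swap p q c : triangle p q c = triangle q p c.
Proof. by rewrite /triangle (setUC [set p]). Qed.

Lemma triangle_rot p q c : triangle p q c = triangle q c p.
Proof. by rewrite /triangle [RHS]setUC setUA. Qed.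

Lemma similarity_affine p q : p != q ->
  similarity (fun u => (u - p) / (q - p)).
Proof.
move=> pq; have Re_k : (complex.Re `|q - p|^-1)%:C = `|q - p|^-1.
  by rewrite RRe_real// ger0_real// invr_ge0.
exists (complex.Re `|q - p|^-1).
  by rewrite -ltcR Re_k invr_gt0 normr_gt0 subr_eq0 eq_sym.
by move=> u v; rewrite -mulrBl opprB addrA subrK normrM normfV mulrC Re_k.
Qed.

Lemma similar_affine p q c : p != q ->
  Defs.similar (triangle p q c) (triangle 0 1 ((c - p) / (q - p))).
Proof.
move=> pq; exists (fun u => (u - p) / (q - p)); first exact: similarity_affine.
rewrite /triangle !image_setU !image_set1 subrr mul0r divff//.
by rewrite subr_eq0 eq_sym.
Qed.

Lemma similar_conj T w :
  Defs.similar T (triangle 0 1 w) -> Defs.similar T (triangle 0 1 w^*).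
Proof.
move=> [f [k k0 fk] fT]; exists (fun u => (f u)^*).
  by exists k => // u v; rewrite -rmorphB normcJ fk.
rewrite -(image_comp f (fun u => u^*)) fT.
by rewrite /triangle !image_setU !image_set1 rmorph0 rmorph1.
Qed.

Lemma sqr_norm_subC x y s : `|x +i* y - s%:C| ^+ 2 = ((x - s) ^+ 2 + y ^+ 2)%:C.
Proof. by rewrite sqr_normc; simpc; congr (_ +i* _); ring. Qed.

Lemma norm_subC x y s t : 0 <= t ->
  `|x +i* y - s%:C| = t%:C <-> (x - s) ^+ 2 + y ^+ 2 = t ^+ 2.
Proof.
move=> t0; split=> e.
  by apply: (@complexI R); rewrite -sqr_norm_subC e rmorphXn.
have tC0 : 0 <= t%:C by rewrite ler0c.
apply/eqP; rewrite -(@eqrXn2 _ 2) ?normr_ge0//.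
by rewrite sqr_norm_subC -rmorphXn e.
Qed.

Lemma GammaP x y : Gamma (x +i* y) <->
  [/\ 0 < x, x <= 2^-1, 0 < y & y ^+ 2 = x * (1 - x)].
Proof.
have half : 2^-1 = (2^-1)%:C :> R[i] by rewrite fmorphV rmorph_nat.
have half0 : 0 <= 2^-1 :> R by rewrite invr_ge0.
rewrite /Gamma /Sigma /= half; split.
  by move=> [[? ? ? _] /(norm_subC _ _ _ _ half0) ?]; split => //; lra.
move=> [x0 xh y0 e]; split; last by apply/norm_subC => //; lra.
(* On the circle, [(x - 1) ^+ 2 + y ^+ 2] equals [1 - x], which is at most 1. *)
split=> //; rewrite -(@expr_le1 _ 2)// -(rmorph1 (real_complex R)).
by rewrite sqr_norm_subC lecR; lra.
Qed.

(* The normalization of a right triangle with legs [`|s|] and [`|t|], its right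
   angle being at the vertex [right_shape s t]. *)
Definition right_shape s t : R[i] :=
  (Num.min (s ^+ 2) (t ^+ 2) / (s ^+ 2 + t ^+ 2))
    +i* (`|s| * `|t| / (s ^+ 2 + t ^+ 2)).

Lemma right_shape_Gamma s t : s != 0 -> t != 0 -> Gamma (right_shape s t).
Proof.
move=> s0 t0; have s2 : 0 < s ^+ 2 by rewrite exprn_even_gt0.
have t2 : 0 < t ^+ 2 by rewrite exprn_even_gt0.
have m0 : 0 < s ^+ 2 + t ^+ 2 by rewrite addr_gt0.
apply/GammaP; split.
- by rewrite divr_gt0// lt_min s2.
- by rewrite ler_pdivrMr//; case: (leP (s ^+ 2)) => ?; lra.
- by rewrite divr_gt0// mulr_gt0// normr_gt0.
(* The real part and its complement to 1 are the two squared legs over their sum, and the product of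
   these fractions is the squared imaginary part. *)
- rewrite expr_div_n exprMn !real_normK ?num_real//.
  by case: (leP (s ^+ 2)) => _; field; rewrite gt_eqF.
Qed.

(** Reflection in the real axis removes the dependence on the orientation of the legs. *)
Lemma similar_norm_Im T x y : Defs.similar T (triangle 0 1 (x +i* y)) ->
  Defs.similar T (triangle 0 1 (x +i* `|y|)).
Proof. by case: (ger0P y) => _ // simT; exact: similar_conj simT. Qed.

Lemma normalization_right c s t : s != 0 -> t != 0 ->
  normalization (triangle c (c + s%:C) (c + (0 +i* t))) = right_shape s t.
Proof.
move=> s0 t0; have [Sw _] := right_shape_Gamma s t s0 t0.
apply: normalizationE => //.
have m0 : 0 < s ^+ 2 + t ^+ 2.
  by rewrite ltr_wpDl ?sqr_ge0// exprn_even_gt0.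
have nm0 : s ^+ 2 + t ^+ 2 != 0 by rewrite gt_eqF.
have normE : `|s| * `|t| / (s ^+ 2 + t ^+ 2) = `|s * t / (s ^+ 2 + t ^+ 2)|.
  by rewrite !normrM normfV (gtr0_norm m0).
have pq : c + s%:C != c + (0 +i* t).
  by rewrite (inj_eq (addrI c)) eq_complex /= negb_and s0.
(* The hypotenuse goes to [[0, 1]], with the endpoint of the shorter leg sent to 0; the apex is then
   the affine image of [c]. *)
rewrite /right_shape normE; have [st|ts] := leP (s ^+ 2) (t ^+ 2).
  apply: similar_norm_Im.
  have -> : s ^+ 2 / (s ^+ 2 + t ^+ 2) +i* (s * t / (s ^+ 2 + t ^+ 2)) =
      (c - (c + s%:C)) / (c + (0 +i* t) - (c + s%:C)).
    apply: (canRL (mulfK _)); first by rewrite subr_eq0 eq_sym.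
    case: c {pq} => a b; simpc.
    by apply/eqP; rewrite eq_complex; apply/andP; split; apply/eqP => /=; field.
  by rewrite triangle_rot; exact: similar_affine.
(* Exchanging the ends of the hypotenuse reverses the sign of the imaginary part. *)
rewrite -normrN; apply: similar_norm_Im.
have -> : t ^+ 2 / (s ^+ 2 + t ^+ 2) +i* - (s * t / (s ^+ 2 + t ^+ 2)) =
    (c - (c + (0 +i* t))) / (c + s%:C - (c + (0 +i* t))).
  apply: (canRL (mulfK _)); first by rewrite subr_eq0.
  case: c {pq} => a b; simpc.
  by apply/eqP; rewrite eq_complex; apply/andP; split; apply/eqP => /=; field.
by rewrite triangle_rot triangle_swap; apply: similar_affine; rewrite eq_sym.
Qed.

(** The right angle is at the foot [x], from which the horizontal leg runs back to 0; hence the sign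
    in [- x]. *)
Lemma W_L_right_shape x y : x != 0 -> y != 0 ->
  W_L (x +i* y) = right_shape (- x) y.
Proof.
move=> x0 y0; rewrite -(normalization_right x%:C) ?oppr_eq0//.
by rewrite /W_L /left_child triangle_swap rmorphN subrr /=; simpc.
Qed.

Lemma W_R_right_shape x y : x != 1 -> y != 0 ->
  W_R (x +i* y) = right_shape (1 - x) y.
Proof.
rewrite eq_sym -subr_eq0 => x1 y0; rewrite -(normalization_right x%:C)//.
by rewrite /W_R /right_child rmorphB rmorph1 addrC subrK /=; simpc.
Qed.

Lemma W_Sigma z : Sigma z -> Gamma (W_L z) /\ Gamma (W_R z).
Proof.
case: z => x y [/= x0 xh y0 _].
have nx0 : x != 0 by rewrite gt_eqF.
have ny0 : y != 0 by rewrite gt_eqF.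
have x1 : x != 1 by apply/eqP => ?; lra.
rewrite W_L_right_shape// W_R_right_shape//.
by split; apply: right_shape_Gamma; rewrite ?oppr_eq0// subr_eq0 eq_sym.
Qed.

Lemma W_Gamma z : Gamma z -> W_L z = z /\ W_R z = z.
Proof.
case: z => x y /GammaP[x0 xh y0 e].
have x1 : 0 < 1 - x by lra.
have nx0 : x != 0 by rewrite gt_eqF.
have nx1 : 1 - x != 0 by rewrite gt_eqF.
have ny0 : y != 0 by rewrite gt_eqF.
have x_neq1 : x != 1 by rewrite eq_sym -subr_eq0.
rewrite W_L_right_shape// W_R_right_shape//.
rewrite /right_shape normrN !gtr0_norm// sqrrN.
(* As [x <= 1 - x], the value [y ^+ 2 = x * (1 - x)] lies between [x ^+ 2] and [(1 - x) ^+ 2]: the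
   altitude is the longer leg on the left and the shorter one on the right. *)
rewrite min_l ?min_r; [|nra|nra].
have -> : x ^+ 2 + y ^+ 2 = x by rewrite e; ring.
have -> : (1 - x) ^+ 2 + y ^+ 2 = 1 - x by rewrite e; ring.
by rewrite e; split; congr (_ +i* _); field.
Qed.

End RightTriangles.

Theorem mainTheorem2 (R : realType) :
  [/\ @W_L R @` @Sigma R = @Gamma R,
      @W_R R @` @Sigma R = @Gamma R
    & forall z : R[i], Gamma z -> W_L z = z /\ W_R z = z].
Proof.
split; last exact: W_Gamma.
- apply/seteqP; split=> [_ [z /W_Sigma[? _] <-]//|z Gz].
  (* Being fixed, a point of [Gamma] is its own preimage. *)
  by exists z; [case: Gz|case: (W_Gamma _ z Gz)].
- apply/seteqP; split=> [_ [z /W_Sigma[_ ?] <-]//|z Gz].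
  by exists z; [case: Gz|case: (W_Gamma _ z Gz)].
Qed.
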